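(* Let $x, \nu \in \mathbb{C}$ and define the infinite lower-triangular matrices $A(x,\nu) = (A_{n,k}(x,\nu))_{n,k \geq 1}$ and $B(x,\nu) = (B_{n,k}(x,\nu))_{n,k\geq 1}$ by $$A_{n,k}(x,\nu) = (-1)^k\binom{n}{k}F(k-n,-n\nu;-n;x), \qquad B_{n,k}(x,\nu) = (-1)^k\binom{n}{k}F(k-n,k\nu;k;x)$$ for $1 \leq k \leq n$ (and $0$ for $k>n$). Then for any pair of complex sequences $(S_n)_{n \geq 1}$ and $(T_n)_{n\geq 1}$ the inversion formula $$\Big( T_n = \sum_{k=1}^{n}A_{n,k}(x,\nu)\,S_k \ \text{ for all } n \geq 1 \Big) \Longleftrightarrow \Big( S_n=\sum_{k=1}^{n}B_{n,k}(x,\nu)\,T_k \ \text{ for all } n\geq 1\Big)$$ holds.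
   Context: For $1\le k\le n$, the Gauss hypergeometric function with first parameter $k-n$ is a polynomial given by the finite sum $F(k-n,\beta;\gamma;x) = \sum_{m=0}^{n-k} \frac{(k-n)_m(\beta)_m}{(\gamma)_m\, m!}x^m$, where $(c)_0=1$ and $(c)_m = c(c+1)\cdots(c+m-1)$ is the Pochhammer symbol. For $\gamma=-n$ this is well defined since $(-n)_m\neq 0$ for $m\le n-k<n$. *)

(* Defs.v *)
From HB Require Import structures.
From mathcomp Require Import all_boot all_order all_algebra.

Set Implicit Arguments.
Unset Strict Implicit.
Unset Printing Implicit Defensive.

Import GRing.Theory.

Local Open Scope ring_scope.

(* Rising factorial (c)_m = c (c + 1) ... (c + m - 1). *)
Definition pochhammer (K : fieldType) (c : K) (m : nat) : K :=
  \prod_(i < m) (c + i%:R).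

(* The Gauss series F(-N, beta; gamma; x), which terminates at m = N.  It is
   the intended polynomial when (gamma)_m != 0 for all m <= N; this holds at
   every use below (N = n - k with k >= 1, and gamma = -n or gamma = k). *)
Definition gauss_poly (K : fieldType) (N : nat) (beta gamma x : K) : K :=
  \sum_(m < N.+1)
    pochhammer (- N%:R) m * pochhammer beta m
      / (pochhammer gamma m * m`!%:R) * x ^+ m.

(* Infinite matrices with rows and columns indexed by the positive integers
   are functions of two naturals, set to 0 outside 1 <= k <= n. *)
Definition matA (K : fieldType) (x nu : K) (n k : nat) : K :=
  if (1 <= k <= n)%N then
    (-1) ^+ k * 'C(n, k)%:R * gauss_poly (n - k) (- n%:R * nu) (- n%:R) x
  else 0.

Definition matB (K : fieldType) (x nu : K) (n k : nat) : K :=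
  if (1 <= k <= n)%N then
    (-1) ^+ k * 'C(n, k)%:R * gauss_poly (n - k) (k%:R * nu) k%:R x
  else 0.

(* Main.v *)
(* Cancelling factorials gives A = V P and B = P U, where
   P_{n,k} = (-1)^k C(n,k) is an involution by binomial inversion and
     V_{n,k} = (-n nu)_{n-k} / (n-k)! x^(n-k)        ([leftA], k <= n),
     U_{n,k} = n/k (k nu)_{n-k} / (n-k)! x^(n-k)     ([rightB], k <= n).
   Since (a)_{m-i} (-a)_i = (-1)^i a (a-i+1)_{m-1}, the (n,k) entry of U V is
   for n > k a multiple of an alternating binomial sum of order n-k of a
   polynomial of degree n-k-1, so U V = 1.  Hence B A = P U V P = 1, and A B = 1
   follows by applying this to finite truncations. *)
Require Import Defs.
From mathcomp Require Import all_boot all_order all_algebra.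
From mathcomp Require Import complex.
From mathcomp Require Import reals.
From mathcomp Require Import zify ring.

Set Implicit Arguments.
Unset Strict Implicit.
Unset Printing Implicit Defensive.

Import GRing.Theory Num.Theory.

Local Open Scope ring_scope.
Local Open Scope complex_scope.

(** * Finite sums and alternating binomial sums *)

(** Meant for an entry of a product of two lower-triangular truncations: only the indices between
    the column [k] and the row [n] contribute. *)
Lemma big_ord_shift_window (V : nmodType) (N k n : nat) (F : nat -> V) :
  (1 <= k <= n)%N -> (n <= N)%N ->
  (forall p, ~~ (k <= p <= n)%N -> F p = 0) ->
  \sum_(p < N) F p.+1 = \sum_(i < (n - k).+1) F (k + i)%N.
Proof.
move=> /andP[k1 kn] nN F0.
rewrite -(big_mkord xpredT (fun p => F p.+1)) -(big_add1 _ _ _ N.+1 xpredT F).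
rewrite (@big_cat_nat _ _ _ k) //=; last by lia.
rewrite [X in _ + X](@big_cat_nat _ _ _ n.+1) //=; last by lia.
rewrite big_nat big1 ?add0r => [|i /andP[_ ik]]; last by apply: F0; lia.
rewrite [X in _ + X]big_nat [X in _ + X]big1 ?addr0 => [|i /andP[ni _]]; last first.
  by apply: F0; lia.
rewrite -{1}[k]add0n big_addn -subSn // big_mkord.
by apply: eq_bigr => i _; rewrite addnC.
Qed.

(* Induction on the degree: in [q * 'X + c] the factor [i] is absorbed by
   [i * 'C(N, i) = N * 'C(N.-1, i.-1)]. *)
Lemma alternating_binomial_poly (K : idomainType) (N : nat) (p : {poly K}) :
  (size p <= N)%N -> \sum_(i < N.+1) (-1) ^+ i * 'C(N, i)%:R * p.[i%:R] = 0.
Proof.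
elim: N p => [|N IHN] p.
  rewrite leqn0 size_poly_eq0 => /eqP p0; rewrite big1 // => i _.
  by rewrite p0 horner0 mulr0.
move=> szp; set q := drop_poly 1 p.
(* Absorbing the factor [i] shifts the index by one, so [q] ends up evaluated at [i.+1]; the
   induction hypothesis is therefore applied to this translate of [q]. *)
have szq : (size (q \Po ('X + 1%:P))%R <= N)%N.
  by rewrite size_comp_poly2 ?size_XaddC // size_drop_poly; lia.
have pE (c : K) : p.[c] = c * q.[c] + (take_poly 1 p)`_0.
  rewrite -{1}(poly_take_drop 1 p) hornerD hornerM hornerXn expr1 addrC mulrC.
  by rewrite {1}[take_poly 1 p]size1_polyC ?hornerC // size_take_poly.
under eq_bigr do rewrite pE mulrDr.
rewrite big_split /= -mulr_suml.
have -> : \sum_(i < N.+2) (-1) ^+ i * 'C(N.+1, i)%:R = 0 :> K.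
  apply: etrans (_ : (1 - 1) ^+ N.+1 = 0); last by rewrite subrr expr0n.
  rewrite exprDn.
  by apply: eq_bigr => i _; rewrite expr1n mul1r mulr_natr.
rewrite mul0r addr0 big_ord_recl mul0r mulr0 add0r.
transitivity (- N.+1%:R *
    \sum_(i < N.+1) (-1) ^+ i * 'C(N, i)%:R * (q \Po ('X + 1%:P)).[i%:R]);
  last by rewrite IHN ?mulr0.
rewrite mulr_sumr; apply: eq_bigr => i _ /=.
rewrite /bump /= add1n horner_comp hornerD hornerX hornerC natr1 exprS.
have /(congr1 (fun n => n%:R : K)) := mul_bin_diag N.+1 i.
rewrite /= !natrM => H.
transitivity (- (-1) ^+ i * (i.+1%:R * 'C(N.+1, i.+1)%:R) * q.[i.+1%:R]); first by ring.
by rewrite -H; ring.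
Qed.

(** * Pochhammer identities *)

Lemma pochhammer0 (K : fieldType) (c : K) : pochhammer c 0 = 1.
Proof. exact: big_ord0. Qed.

Lemma pochhammer1 (K : fieldType) (c : K) : pochhammer c 1 = c.
Proof. by rewrite /pochhammer big_ord1 addr0. Qed.

Lemma pochhammerSr (K : fieldType) (c : K) (m : nat) :
  pochhammer c m.+1 = pochhammer c m * (c + m%:R).
Proof. exact: big_ord_recr. Qed.

Lemma pochhammerD (K : fieldType) (c : K) (m n : nat) :
  pochhammer c (m + n) = pochhammer c m * pochhammer (c + m%:R) n.
Proof.
rewrite /pochhammer big_split_ord /=; congr (_ * _).
by apply: eq_bigr => i _; rewrite natrD addrA.
Qed.

Lemma pochhammerN (K : fieldType) (c : K) (m : nat) :
  pochhammer (- c) m = (-1) ^+ m * pochhammer (c - m%:R + 1) m.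
Proof.
rewrite /pochhammer (reindex_inj rev_ord_inj) /=.
rewrite -[X in (-1) ^+ X]card_ord -prodr_const -big_split /=.
by apply: eq_bigr => i _; rewrite natrB ?ltn_ord // -natr1; ring.
Qed.

(** After reflection by [pochhammerN], the factors of the second symbol run from a-i+1 to a, and
    those of the first from a to a+N-i. Pulling out one factor [a] leaves the [N] consecutive
    factors from a-i+1 to a+N-i. *)
Lemma pochhammer_mulN (K : fieldType) (a : K) (N i : nat) :
  (i <= N.+1)%N ->
  pochhammer a (N.+1 - i) * pochhammer (- a) i
    = a * (-1) ^+ i * pochhammer (a - i%:R + 1) N.
Proof.
(* For i = 0 the reflected product is empty, so the extracted [a] is the first factor of the other
   symbol; otherwise it is the last factor of the reflected one. *)
rewrite pochhammerN; case: i => [|i] iN.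
  by rewrite subn0 -add1n pochhammerD pochhammer1 !pochhammer0 subr0; ring.
rewrite pochhammerSr.
have -> : pochhammer (a - i.+1%:R + 1) N
   = pochhammer (a - i.+1%:R + 1) i * pochhammer a (N.+1 - i.+1).
  rewrite -[in LHS](subnKC (_ : i <= N)%N) // pochhammerD subSS.
  congr (_ * pochhammer _ _).
  by rewrite -natr1; ring.
by rewrite -natr1; ring.
Qed.

Lemma pochhammerN_nat (K : fieldType) (n m : nat) :
  (m <= n)%N -> pochhammer (- n%:R : K) m = (-1) ^+ m * (n ^_ m)%:R.
Proof.
move=> mn; rewrite ffact_prod natr_prod /pochhammer.
rewrite -[X in (-1) ^+ X]card_ord -prodr_const -big_split /=.
apply: eq_bigr => i _; rewrite natrB; last by have := ltn_ord i; lia.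
by ring.
Qed.

Lemma pochhammer_nat (K : fieldType) (k m : nat) :
  pochhammer (k.+1%:R : K) m * k`!%:R = (k + m)`!%:R.
Proof.
elim: m => [|m IHm]; first by rewrite /pochhammer big_ord0 mul1r addn0.
rewrite pochhammerSr mulrAC IHm addnS factS.
by rewrite natrM mulrC -natrD addSn.
Qed.

(** * The triangular factors and their inverses *)

Definition signed_binomial (K : fieldType) (n k : nat) : K :=
  (-1) ^+ k * 'C(n, k)%:R.

(** The coefficient of t^m in (1 - x t)^(-c). *)
Definition rising_coef (K : fieldType) (x c : K) (m : nat) : K :=
  pochhammer c m / m`!%:R * x ^+ m.

Definition leftA (K : fieldType) (x nu : K) (n k : nat) : K :=
  if (k <= n)%N then rising_coef x (- n%:R * nu) (n - k) else 0.

(** With f(t) = (1 - x t)^nu, [leftA] has entries [t^(n-k)] f^n and [rightB] has entries n/k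
    [t^(n-k)] f^(-k): the inverse pair of Lagrange inversion. *)
Definition rightB (K : fieldType) (x nu : K) (n k : nat) : K :=
  if (k <= n)%N then n%:R / k%:R * rising_coef x (k%:R * nu) (n - k) else 0.

Lemma natr_fact_neq0 (K : numFieldType) (m : nat) : m`!%:R != 0 :> K.
Proof. by rewrite pnatr_eq0 -lt0n fact_gt0. Qed.

Lemma bin_trinomial (n k i : nat) :
  (k + i <= n)%N -> ('C(n, k + i) * 'C(k + i, k) = 'C(n, k) * 'C(n - k, i))%N.
Proof.
move=> kin; apply/eqP.
have f0 : (0 < k`! * i`! * (n - (k + i))`!)%N by rewrite !muln_gt0 !fact_gt0.
rewrite -(eqn_pmul2r f0); apply/eqP.
transitivity n`!.
  rewrite -(bin_fact kin) -(bin_fact (leq_addr i k)) addKn; lia.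
have kn : (k <= n)%N by lia.
have ink : (i <= n - k)%N by lia.
by rewrite -(bin_fact kn) -(bin_fact ink) subnDA; lia.
Qed.

Lemma signed_binomialK (K : numFieldType) (N n k : nat) :
  (1 <= k)%N -> (n <= N)%N ->
  \sum_(p < N) signed_binomial K n p.+1 * signed_binomial K p.+1 k = (n == k)%:R.
Proof.
move=> k1 nN; rewrite /signed_binomial.
have [nk|kn] := ltnP n k.
  rewrite (ltn_eqF nk) big1 // => p _; have [np|pn] := ltnP n p.+1.
    by rewrite bin_small // mulr0 mul0r.
  by rewrite [in X in _ * X]bin_small ?mulr0 //; lia.
rewrite (@big_ord_shift_window _ N k n
  (fun p => (-1) ^+ p * 'C(n, p)%:R * ((-1) ^+ k * 'C(p, k)%:R))) ?k1 //; last first.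
  move=> p; rewrite negb_and -!ltnNge => /orP[pk|np].
    by rewrite [in X in _ * X]bin_small ?mulr0.
  by rewrite bin_small // mulr0 mul0r.
(* Trinomial revision pulls out ['C(n, k)]; what remains is the alternating sum of order n-k of the
   constant polynomial 1, which vanishes for n > k. *)
transitivity ('C(n, k)%:R *
    \sum_(i < (n - k).+1) (-1) ^+ i * 'C(n - k, i)%:R * (1 : {poly K}).[i%:R]).
  rewrite mulr_sumr; apply: eq_bigr => i _; rewrite hornerC mulr1.
  have H : 'C(n, k + i)%:R * 'C(k + i, k)%:R = 'C(n, k)%:R * 'C(n - k, i)%:R :> K.
    by rewrite -!natrM bin_trinomial //; have := ltn_ord i; lia.
  rewrite [RHS]mulrCA -H exprD.
  transitivity (((-1) ^+ k * (-1) ^+ k) *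
      ((-1) ^+ i * ('C(n, k + i)%:R * 'C(k + i, k)%:R)) : K).
    by ring.
  by rewrite -exprMn mulrNN mulr1 expr1n mul1r.
have [->|nk] := eqVneq n k; first by rewrite subnn big_ord1 !binn hornerC expr0 !mulr1.
by rewrite alternating_binomial_poly ?mulr0 // size_poly1; lia.
Qed.

Lemma rightB_leftA (K : numFieldType) (x nu : K) (N p q : nat) :
  (1 <= q)%N -> (p <= N)%N ->
  \sum_(j < N) rightB x nu p j.+1 * leftA x nu j.+1 q = (p == q)%:R.
Proof.
move=> q1 pN; rewrite /rightB /leftA.
have [pq|qp] := ltnP p q.
  rewrite (ltn_eqF pq) big1 // => j _.
  have [jp|_] := leqP j.+1 p; last by rewrite mul0r.
  by have [qj|_] := leqP q j.+1; [lia | rewrite mulr0].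
rewrite (@big_ord_shift_window _ N q p
  (fun j => (if (j <= p)%N then p%:R / j%:R * rising_coef x (j%:R * nu) (p - j) else 0) *
    (if (q <= j)%N then rising_coef x (- j%:R * nu) (j - q) else 0))) ?q1 //; last first.
  move=> j; have [qj|_ _] := leqP q j; last by rewrite mulr0.
  by have [//|_ _] := leqP j p; rewrite mul0r.
have [<-|npq] := eqVneq p q.
  have p0 : p%:R != 0 :> K by rewrite pnatr_eq0; lia.
  rewrite subnn big_ord1 addn0 leqnn subnn /rising_coef !pochhammer0 !expr0.
  by rewrite fact0 !(mulr1, divr1) divff.
case dE: (p - q)%N => [|d]; first by lia.
(* With a = (q+i) nu, each factor a-i+1+t of the symbol (a-i+1)_d is affine in [i] with slope nu-1;
   [P] is that symbol as a polynomial in [i]. *)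
pose P := \prod_(t < d) ((q%:R * nu + 1 + t%:R)%:P + (nu - 1) *: 'X) : {poly K}.
have szP : (size P <= d.+1)%N.
  rewrite /P; elim: d {dE P} => [|d IHd]; first by rewrite big_ord0 size_poly1.
  rewrite big_ord_recr /=; apply: leq_trans (size_polyMleq _ _) _.
  suff : (size ((q%:R * nu + 1 + d%:R)%:P + (nu - 1) *: 'X)%R <= 2)%N.
    move=> szl; have -> : d.+2 = (d.+1 + 2).-1 by lia.
    by rewrite -!subn1 leq_sub2r // leq_add.
  rewrite (leq_trans (size_polyD _ _)) // geq_max (leq_trans (size_polyC_leq1 _)) //=.
  by rewrite (leq_trans (size_scale_leq _ _)) // size_polyX.
have PE i : P.[i%:R] = pochhammer ((q + i)%:R * nu - i%:R + 1) d.
  rewrite horner_prod; apply: eq_bigr => t _.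
  by rewrite hornerD hornerC hornerZ hornerX natrD; ring.
(* The factor a = (q+i) nu given by [pochhammer_mulN] cancels the denominator q+i of [rightB], so
   the prefactor does not depend on [i]. *)
transitivity (p%:R * nu * x ^+ d.+1 / d.+1`!%:R *
   \sum_(i < d.+2) (-1) ^+ i * 'C(d.+1, i)%:R * P.[i%:R]); last first.
  by rewrite alternating_binomial_poly ?mulr0.
rewrite mulr_sumr; apply: eq_bigr => i _.
have iD : (i <= d.+1)%N by have := ltn_ord i; lia.
rewrite leq_addr addKn PE.
have -> : (q + i <= p)%N by lia.
have -> : (p - (q + i) = d.+1 - i)%N by lia.
rewrite /rising_coef mulNr.
have H := @pochhammer_mulN _ ((q + i)%:R * nu) d i iD.
have F : 'C(d.+1, i)%:R * i`!%:R * (d.+1 - i)`!%:R = d.+1`!%:R :> K.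
  by rewrite -!natrM -mulnA bin_fact.
rewrite -[in x ^+ d.+1](subnK iD) exprD -F.
have f1 := natr_fact_neq0 K i; have f2 := natr_fact_neq0 K (d.+1 - i).
have b0 : 'C(d.+1, i)%:R != 0 :> K by rewrite pnatr_eq0 -lt0n bin_gt0.
have qi0 : (q + i)%:R != 0 :> K by rewrite pnatr_eq0; lia.
transitivity (p%:R / (q + i)%:R *
     (pochhammer ((q + i)%:R * nu) (d.+1 - i) * pochhammer (- ((q + i)%:R * nu)) i)
   / (i`!%:R * (d.+1 - i)`!%:R) * (x ^+ (d.+1 - i) * x ^+ i)).
  by field; rewrite f2 f1 -natrD qi0.
by rewrite H; field; rewrite f2 f1 b0 -natrD qi0.
Qed.

(** * Factorization of the two hypergeometric matrices *)

(** Term [m] of the Gauss polynomial is the summand p = n-m: the signs of (k-n)_m and (-n)_m cancel,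
    and their quotient turns C(n,k) into C(n-m,k). *)
Lemma matA_factor (K : numFieldType) (x nu : K) (N n k : nat) :
  (1 <= k)%N -> (n <= N)%N ->
  matA x nu n k = \sum_(p < N) leftA x nu n p.+1 * signed_binomial K p.+1 k.
Proof.
move=> k1 nN; rewrite /matA /leftA /signed_binomial k1 /=.
have [kn|nk] := leqP k n; last first.
  rewrite big1 // => p _; have [pn|_] := leqP p.+1 n; last by rewrite mul0r.
  by rewrite bin_small ?mulr0 //; lia.
rewrite (@big_ord_shift_window _ N k n (fun p =>
   (if (p <= n)%N then rising_coef x (- n%:R * nu) (n - p) else 0) *
   ((-1) ^+ k * 'C(p, k)%:R))) ?k1 //; last first.
  move=> p; have [kp|pk _] := leqP k p; last by rewrite bin_small // !mulr0.
  by have [//|_ _] := leqP p n; rewrite mul0r.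
rewrite [RHS](reindex_inj rev_ord_inj) /= mulr_sumr; apply: eq_bigr => m _ /=.
have mnk : (m <= n - k)%N by have := ltn_ord m; lia.
have mn : (m <= n)%N by lia.
have -> : (k + ((n - k).+1 - m.+1) = n - m)%N by lia.
rewrite leq_subr subKn // /rising_coef !pochhammerN_nat //.
(* Multiplied by k! (n-k-m)!, both sides become n!. *)
have H : 'C(n, k)%:R * ((n - k) ^_ m)%:R = 'C(n - m, k)%:R * (n ^_ m)%:R :> K.
  rewrite -!natrM; congr _%:R; apply/eqP.
  have f0 : (0 < k`! * (n - k - m)`!)%N by rewrite !muln_gt0 !fact_gt0.
  rewrite -(eqn_pmul2r f0); apply/eqP; transitivity n`!.
    by rewrite -(bin_fact kn) -(ffact_fact mnk); lia.
  have knm : (k <= n - m)%N by lia.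
  rewrite -(ffact_fact mn) -(bin_fact knm).
  have -> : (n - m - k = n - k - m)%N by lia.
  by lia.
have f1 := natr_fact_neq0 K m.
have f2 : (n ^_ m)%:R != 0 :> K by rewrite pnatr_eq0 -lt0n ffact_gt0.
have s0 : (-1) ^+ m != 0 :> K by rewrite signr_eq0.
transitivity ((-1) ^+ k * ('C(n, k)%:R * ((n - k) ^_ m)%:R) * pochhammer (- n%:R * nu) m
   / ((n ^_ m)%:R * m`!%:R) * x ^+ m).
  by field; rewrite f1 f2 s0.
by rewrite H; field; rewrite f1 f2.
Qed.

(** Here term [m] is the summand p = k+m: the sign of (k-n)_m completes (-1)^k to (-1)^(k+m), and
    dividing by (k)_m turns C(n,k) into C(n,k+m) (k+m)/k. *)
Lemma matB_factor (K : numFieldType) (x nu : K) (N n k : nat) :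
  (1 <= k)%N -> (n <= N)%N ->
  matB x nu n k = \sum_(p < N) signed_binomial K n p.+1 * rightB x nu p.+1 k.
Proof.
case: k => // k _ nN; rewrite /matB /rightB /signed_binomial /=.
have [kn|nk] := leqP k.+1 n; last first.
  rewrite big1 // => p _; have [pn|_] := leqP k.+1 p.+1; last by rewrite mulr0.
  by rewrite bin_small ?mulr0 ?mul0r //; lia.
rewrite (@big_ord_shift_window _ N k.+1 n (fun p => (-1) ^+ p * 'C(n, p)%:R *
   (if (k.+1 <= p)%N then p%:R / k.+1%:R * rising_coef x (k.+1%:R * nu) (p - k.+1) else 0))) //; last first.
  move=> p; have [kp|_ _] := leqP k.+1 p; last by rewrite mulr0.
  by have [//|np _] := leqP p n; rewrite bin_small // mulr0 mul0r.
rewrite mulr_sumr; apply: eq_bigr => m _ /=.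
have mnk : (m <= n - k.+1)%N by have := ltn_ord m; lia.
have kmn : (k.+1 + m <= n)%N by lia.
rewrite leq_addr addKn /rising_coef pochhammerN_nat // exprD.
(* The column is now k+1; multiplied by k! (n-k-1-m)!, both sides become n!. *)
have H : 'C(n, k.+1)%:R * ((n - k.+1) ^_ m)%:R * k.+1%:R
    = pochhammer k.+1%:R m * 'C(n, k.+1 + m)%:R * (k.+1 + m)%:R :> K.
  apply: (mulIf (natr_fact_neq0 K k)).
  have -> : pochhammer k.+1%:R m * 'C(n, k.+1 + m)%:R * (k.+1 + m)%:R * k`!%:R
    = (pochhammer k.+1%:R m * k`!%:R) * 'C(n, k.+1 + m)%:R * (k.+1 + m)%:R :> K by ring.
  rewrite pochhammer_nat -!natrM; congr _%:R; apply/eqP.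
  rewrite -(eqn_pmul2r (fact_gt0 (n - k.+1 - m))); apply/eqP; transitivity n`!.
    by rewrite -(bin_fact kn) -(ffact_fact mnk) factS; lia.
  by rewrite -(bin_fact kmn) -subnDA addSn factS; lia.
have f1 := natr_fact_neq0 K m.
have k0 : k.+1%:R != 0 :> K by rewrite pnatr_eq0.
have p0 : pochhammer k.+1%:R m != 0 :> K.
  apply: contraTneq (natr_fact_neq0 K (k + m)) => p0.
  by rewrite -pochhammer_nat p0 mul0r eqxx.
transitivity ((-1) ^+ k.+1 * (-1) ^+ m * ('C(n, k.+1)%:R * ((n - k.+1) ^_ m)%:R * k.+1%:R) *
     pochhammer (k.+1%:R * nu) m
   / (k.+1%:R * pochhammer k.+1%:R m * m`!%:R) * x ^+ m).
  by field; rewrite f1 p0 nat1r k0.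
by rewrite H; field; rewrite f1 p0 nat1r k0.
Qed.

(** * Truncations and the inversion formula *)

(** Finite square blocks are used because there a one-sided inverse is two-sided; ordinal [i] stands
    for the index [i.+1]. *)
Definition truncation (K : fieldType) (N : nat) (M : nat -> nat -> K) : 'M[K]_N :=
  \matrix_(i, j) M i.+1 j.+1.

Lemma truncation_matBA (K : numFieldType) (x nu : K) (N : nat) :
  truncation N (matB x nu) *m truncation N (matA x nu) = 1%:M.
Proof.
pose P := truncation N (signed_binomial K).
pose U := truncation N (rightB x nu); pose V := truncation N (leftA x nu).
have -> : truncation N (matB x nu) = P *m U.
  apply/matrixP => i j; rewrite !mxE (@matB_factor _ _ _ N) //.
  by apply: eq_bigr => p _; rewrite !mxE.
have -> : truncation N (matA x nu) = V *m P.
  apply/matrixP => i j; rewrite !mxE (@matA_factor _ _ _ N) //.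
  by apply: eq_bigr => p _; rewrite !mxE.
have UV : U *m V = 1%:M.
  apply/matrixP => i j; rewrite !mxE.
  under eq_bigr do rewrite !mxE.
  by rewrite rightB_leftA // eqSS.
rewrite -mulmxA (mulmxA U) UV mul1mx.
apply/matrixP => i j; rewrite !mxE.
under eq_bigr do rewrite !mxE.
by rewrite signed_binomialK // eqSS.
Qed.

(** By triangularity, row [n] involves only the first [n] terms of [X], so the infinite system
    amounts to all its finite truncations. *)
Lemma lower_triangular_transform (K : fieldType) (M : nat -> nat -> K) (X Y : nat -> K) :
  (forall n k, (n < k)%N -> M n k = 0) ->
  (forall n, (1 <= n)%N -> Y n = \sum_(1 <= k < n.+1) M n k * X k) <->
  (forall N, \col_(i < N) Y i.+1 = truncation N M *m \col_(i < N) X i.+1).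
Proof.
move=> M0.
have sumE N (i : 'I_N) : (truncation N M *m \col_(j < N) X j.+1) i ord0
    = \sum_(1 <= k < i.+2) M i.+1 k * X k.
  rewrite !mxE; under eq_bigr do rewrite !mxE.
  rewrite -(big_mkord xpredT (fun j => M i.+1 j.+1 * X j.+1)).
  rewrite -(big_add1 _ _ _ N.+1 xpredT (fun k => M i.+1 k * X k)).
  rewrite (@big_cat_nat _ _ _ i.+2) //= ?ltnS //.
  rewrite [X in _ + X]big_nat [X in _ + X]big1 ?addr0 // => k /andP[ik _].
  by rewrite M0 ?mul0r.
split=> [YX N|YX [//|n] _].
  by apply/matrixP => i j; rewrite ord1 sumE mxE YX.
(* Equation [n.+1] is the last row of the truncation of size [n.+1]. *)
by have /matrixP/(_ ord_max ord0) := YX n.+1; rewrite sumE mxE.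
Qed.

Theorem theorem2p1 (R : realType) (x nu : R[i]) (S T : nat -> R[i]) :
  (forall n : nat, (1 <= n)%N ->
     T n = \sum_(1 <= k < n.+1) matA x nu n k * S k)
  <->
  (forall n : nat, (1 <= n)%N ->
     S n = \sum_(1 <= k < n.+1) matB x nu n k * T k).
Proof.
have A0 n k : (n < k)%N -> matA x nu n k = 0.
  by rewrite /matA ltnNge andbC => /negbTE->.
have B0 n k : (n < k)%N -> matB x nu n k = 0.
  by rewrite /matB ltnNge andbC => /negbTE->.
split=> [/(lower_triangular_transform _ _ A0) TS|/(lower_triangular_transform _ _ B0) ST].
  apply/(lower_triangular_transform _ _ B0) => N.
  by rewrite TS mulmxA truncation_matBA mul1mx.
apply/(lower_triangular_transform _ _ A0) => N.
by rewrite ST mulmxA (mulmx1C (truncation_matBA x nu N)) mul1mx.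
Qed.
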